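(* Localic and hyperconnected restriction functors are orthogonal: for every commutative square $GH=KF$ of restriction functors, with $H\colon\mathcal{C}\to\mathcal{E}$, $F\colon\mathcal{C}\to\mathcal{D}$ localic, $G\colon\mathcal{E}\to\mathcal{F}$ hyperconnected and $K\colon\mathcal{D}\to\mathcal{F}$, there is a unique restriction functor $J\colon\mathcal{D}\to\mathcal{E}$ with $JF=H$ and $GJ=K$.
   Context: A restriction category is a category $\mathcal{C}$ with an operation assigning to each $f\colon A\to B$ a map $\bar f\colon A\to A$ such that: (R1) $f\bar f=f$; (R2) $\bar f\bar g=\bar g\bar f$ for $f\colon A\to B$, $g\colon A\to C$; (R3) $\overline{g\bar f}=\bar g\bar f$ for $f\colon A\to B$, $g\colon A\to C$; (R4) $\bar g f=f\,\overline{gf}$ for $f\colon A\to B$, $g\colon B\to C$. A restriction functor is a functor with $F\bar f=\overline{Ff}$. Each homset is partially ordered by $f\leqslant g$ iff $g\bar f=f$. A restriction idempotent on $A$ is an endomorphism $e$ of $A$ with $\bar e=e$; $\mathcal{O}(A)$ is the set of these. A restriction functor $F\colon\mathcal{C}\to\mathcal{D}$ is hyperconnected if for each $A\in\mathcal{C}$ the map $\mathcal{O}(A)\to\mathcal{O}(FA)$, $e\mapsto Fe$, is an isomorphism (bijection). It is localic if it is bijective on objects and for every map $g\colon FA\to FB$ in $\mathcal{D}$ the poset of maps $f\colon A\to B$ in $\mathcal{C}$ with $g\leqslant Ff$ is downwards-directed (in particular, nonempty). *)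

(* Defs.v *)
From mathcomp Require Import all_boot.

Set Implicit Arguments.
Unset Strict Implicit.
Unset Printing Implicit Defensive.

Declare Scope rcat_scope.
Delimit Scope rcat_scope with rcat.
Local Open Scope rcat_scope.

Record category := Category {
  ob :> Type;
  hom : ob -> ob -> Type;
  idm : forall A, hom A A;
  compm : forall A B C, hom B C -> hom A B -> hom A C;
  comp1m : forall A B (f : hom A B), compm (idm B) f = f;
  compm1 : forall A B (f : hom A B), compm f (idm A) = f;
  compmA : forall A B C D (h : hom C D) (g : hom B C) (f : hom A B),
    compm h (compm g f) = compm (compm h g) f
}.

Arguments hom {_} A B.
Arguments idm {_} A.
Arguments compm {_ A B C} g f.

Notation "g ∘ f" := (compm g f) (at level 40, left associativity) : rcat_scope.

Record rcategory := RCategory {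
  rcat_cat :> category;
  rst : forall A B : rcat_cat, hom A B -> hom A A;
  rstR1 : forall (A B : rcat_cat) (f : hom A B), f ∘ rst f = f;
  rstR2 : forall (A B C : rcat_cat) (f : hom A B) (g : hom A C),
    rst f ∘ rst g = rst g ∘ rst f;
  rstR3 : forall (A B C : rcat_cat) (f : hom A B) (g : hom A C),
    rst (g ∘ rst f) = rst g ∘ rst f;
  rstR4 : forall (A B C : rcat_cat) (f : hom A B) (g : hom B C),
    rst g ∘ f = f ∘ rst (g ∘ f)
}.

Arguments rst {_ A B} f.

Definition hom_le (C : rcategory) (A B : C) (f g : hom A B) : Prop :=
  g ∘ rst f = f.

Notation "f ⩽ g" := (hom_le f g) (at level 70, no associativity) : rcat_scope.

Definition ridem (C : rcategory) (A : C) : Type := {e : hom A A | rst e = e}.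

Record functor (C D : category) := Functor {
  fob :> C -> D;
  fmap : forall A B : C, hom A B -> hom (fob A) (fob B);
  fmap1 : forall A : C, fmap (idm A) = idm (fob A);
  fmapM : forall (A B E : C) (g : hom B E) (f : hom A B),
    fmap (g ∘ f) = fmap g ∘ fmap f
}.

Arguments fmap {C D} F {A B} f : rename.

Record rfunctor (C D : rcategory) := RFunctor {
  rfun_fun :> functor C D;
  fmap_rst : forall (A B : C) (f : hom A B),
    fmap rfun_fun (rst f) = rst (fmap rfun_fun f)
}.

Lemma fcomp_1 (C D E : category) (G : functor D E) (F : functor C D) (A : C) :
  fmap G (fmap F (idm A)) = idm (G (F A)).
Proof. by rewrite !fmap1. Qed.

Lemma fcomp_M (C D E : category) (G : functor D E) (F : functor C D)
    (A B X : C) (g : hom B X) (f : hom A B) :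
  fmap G (fmap F (g ∘ f)) = fmap G (fmap F g) ∘ fmap G (fmap F f).
Proof. by rewrite !fmapM. Qed.

Definition fcomp (C D E : category) (G : functor D E) (F : functor C D) :
    functor C E :=
  @Functor C E (fun A => G (F A)) (fun A B f => fmap G (fmap F f))
    (fcomp_1 G F) (fcomp_M G F).

Lemma rfcomp_rst (C D E : rcategory) (G : rfunctor D E) (F : rfunctor C D)
    (A B : C) (f : hom A B) :
  fmap (fcomp G F) (rst f) = rst (fmap (fcomp G F) f).
Proof. by rewrite /= !fmap_rst. Qed.

Definition rfcomp (C D E : rcategory) (G : rfunctor D E) (F : rfunctor C D) :
    rfunctor C E :=
  @RFunctor C E (fcomp G F) (rfcomp_rst G F).

Notation "G ⊚ F" := (rfcomp G F) (at level 40, left associativity) : rcat_scope.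

Lemma ridem_map_subproof (C D : rcategory) (F : rfunctor C D) (A : C)
    (e : ridem A) :
  rst (fmap F (sval e)) = fmap F (sval e).
Proof. by rewrite -fmap_rst (svalP e). Qed.

Definition ridem_map (C D : rcategory) (F : rfunctor C D) (A : C)
    (e : ridem A) : ridem (F A) :=
  exist _ (fmap F (sval e)) (ridem_map_subproof F e).

Definition hyperconnected (C D : rcategory) (F : rfunctor C D) : Prop :=
  forall A : C, bijective (@ridem_map C D F A).

Definition down_directed (T : Type) (le : T -> T -> Prop) (P : T -> Prop) :
    Prop :=
  (exists x, P x) /\
  (forall x y, P x -> P y -> exists z, [/\ P z, le z x & le z y]).

Definition localic (C D : rcategory) (F : rfunctor C D) : Prop :=
  bijective (fob F) /\
  (forall (A B : C) (g : hom (F A) (F B)),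
     down_directed (@hom_le C A B) (fun f : hom A B => g ⩽ fmap F f)).

(* Main.v *)
Require Import Defs.
From mathcomp Require Import all_boot.
From mathcomp Require Import boolp.

(** Write a square as [G H = K F], with [F] localic and [G] hyperconnected. A
    filler [J] must agree with [H] on objects, up to the bijection [F] on
    objects. On a map [g] of D it must satisfy [G (J g) = K g], and it must be
    monotone: whenever [g ⩽ F f], [J g ⩽ J (F f) = H f]. These two constraints
    determine [J g]. Call a map [j] a lift of [g] if [G j = K g] and [j ⩽ H f]
    for some [f] with [g ⩽ F f].

    - A lift exists ([lift_exists]): localicity gives some [f] with [g ⩽ F f],
      and hyperconnectedness gives a restriction idempotent [d] with
      [G d = rst (K g)]; then [H f ∘ d] is a lift.
    - It is unique ([lift_unique]): for lifts below [H f1] and [H f2],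
      directedness gives [f0] below both [f1] and [f2] and still above [g].
      Because [G] is injective on restriction idempotents, it reflects the
      order between maps that have a common upper bound
      ([hyperconnected_reflects_le]), so both lifts lie below [H f0], and then
      coincide since [G] identifies them.

    Lifts are closed under identities, composition and restriction, so
    uniqueness makes [J] a restriction functor. It also gives the equations
    [J F = H], since [H f] is a lift of [F f], and the uniqueness of [J], since
    any filler sends maps to lifts.

    Equality of functors includes equality of their object parts, so all these
    comparisons take place across equalities of objects. They are expressed by
    transporting maps along such equalities ([hcast]). Proof irrelevance makes
    the transport independent of the chosen equality proofs. *)

Set Implicit Arguments.
Unset Strict Implicit.
Unset Printing Implicit Defensive.

Local Open Scope rcat_scope.

(** * The order on maps of a restriction category *)

Section Order.
Context (C : rcategory).
Implicit Types A B X : C.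

Lemma rst_id A : rst (idm A) = idm A.
Proof. by rewrite -[LHS]comp1m rstR1. Qed.

Lemma rst_rst A B (f : hom A B) : rst (rst f) = rst f.
Proof. by have := rstR3 f (idm A); rewrite rst_id !comp1m. Qed.

Lemma le_antisym A B (f g : hom A B) : f ⩽ g -> g ⩽ f -> f = g.
Proof.
rewrite /hom_le => fg gf.
by rewrite -fg -{1}gf -compmA rstR2 compmA rstR1.
Qed.

Lemma le_rst A B (f g : hom A B) : f ⩽ g -> rst f ⩽ rst g.
Proof. by rewrite /hom_le rst_rst -rstR3 => ->. Qed.

Lemma le_comp A B X (f f' : hom A B) (g g' : hom B X) :
  f ⩽ f' -> g ⩽ g' -> g ∘ f ⩽ g' ∘ f'.
Proof.
rewrite /hom_le => ff' gg'.
have -> : rst (g ∘ f) = rst (g ∘ f') ∘ rst f by rewrite -rstR3 -compmA ff'.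
rewrite compmA -(compmA g') -rstR4.
by rewrite -compmA -compmA ff' compmA gg'.
Qed.

Lemma comp_ridem_le A B (f : hom A B) (d : hom A A) :
  rst d = d -> f ∘ d ⩽ f.
Proof. by rewrite /hom_le => <-; rewrite rstR3 compmA rstR1. Qed.

End Order.

Lemma fmap_le (C D : rcategory) (F : rfunctor C D) (A B : C) (f g : hom A B) :
  f ⩽ g -> fmap F f ⩽ fmap F g.
Proof. by rewrite /hom_le -fmap_rst -fmapM => ->. Qed.

(** * Transport of maps along equalities of objects *)

Definition hcast (C : category) (A A' B B' : C) (eA : A = A') (eB : B = B')
    (f : hom A B) : hom A' B' :=
  match eA in _ = X, eB in _ = Y return hom X Y with
  | erefl, erefl => f
  end.

Section Transport.
Context (C : category).
Implicit Types A B X : C.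

Lemma hcast_id A B (eA : A = A) (eB : B = B) (f : hom A B) :
  hcast eA eB f = f.
Proof.
by rewrite (Prop_irrelevance eA erefl) (Prop_irrelevance eB erefl).
Qed.

(** The composite equalities on the right are arbitrary, so that rewriting
    with this lemma needs no computation on equality proofs. *)
Lemma hcast_trans A A' A'' B B' B'' (eA : A = A') (eA' : A' = A'')
    (eB : B = B') (eB' : B' = B'') (dA : A = A'') (dB : B = B'')
    (f : hom A B) :
  hcast eA' eB' (hcast eA eB f) = hcast dA dB f.
Proof.
case: _ / eA' dA => dA; case: _ / eB' dB => dB.
by case: _ / eA dA => dA; case: _ / eB dB => dB; rewrite !hcast_id.
Qed.

Lemma hcast_inj A A' B B' (eA : A = A') (eB : B = B') :
  injective (@hcast C A A' B B' eA eB).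
Proof. by case: _ / eA; case: _ / eB. Qed.

Lemma hcast_idm A A' (eA : A = A') : hcast eA eA (idm A) = idm A'.
Proof. by case: _ / eA. Qed.

Lemma hcast_comp A A' B B' X X' (eA : A = A') (eB : B = B') (eX : X = X')
    (g : hom B X) (f : hom A B) :
  hcast eA eX (g ∘ f) = hcast eB eX g ∘ hcast eA eB f.
Proof. by case: _ / eA; case: _ / eB; case: _ / eX. Qed.

End Transport.

Lemma hcast_rst (C : rcategory) (A A' B B' : C) (eA : A = A') (eB : B = B')
    (f : hom A B) :
  hcast eA eA (rst f) = rst (hcast eA eB f).
Proof. by case: _ / eA; case: _ / eB. Qed.

Lemma hcast_le (C : rcategory) (A A' B B' : C) (eA : A = A') (eB : B = B')
    (f g : hom A B) :
  hcast eA eB f ⩽ hcast eA eB g <-> f ⩽ g.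
Proof. by case: _ / eA; case: _ / eB. Qed.

(** As in [hcast_trans], the equalities on the right are arbitrary. *)
Lemma fmap_hcast (C D : category) (F : functor C D) (A A' B B' : C)
    (eA : A = A') (eB : B = B') (dA : F A = F A') (dB : F B = F B')
    (f : hom A B) :
  fmap F (hcast eA eB f) = hcast dA dB (fmap F f).
Proof.
by case: _ / eA dA => dA; case: _ / eB dB => dB; rewrite !hcast_id.
Qed.

Lemma rfunctor_eqP (C D : rcategory) (F G : rfunctor C D) :
  F = G <->
  exists e : forall A, F A = G A,
    forall A B (f : hom A B), hcast (e A) (e B) (fmap F f) = fmap G f.
Proof.
split=> [->|[]].
  by exists (fun A => erefl).
case: F G => [[F0 F1 F2 F3] F4] [[G0 G1 G2 G3] G4] /= e.
have e0 : F0 = G0 by apply: functional_extensionality_dep.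
case: _ / e0 G1 G2 G3 G4 e => G1 G2 G3 G4 e FG.
have e1 : F1 = G1.
  apply: functional_extensionality_dep => A.
  apply: functional_extensionality_dep => B.
  by apply: functional_extensionality_dep => f; rewrite -FG hcast_id.
case: _ / e1 G2 G3 G4 {FG} => G2 G3 G4.
rewrite (Prop_irrelevance F2 G2) (Prop_irrelevance F3 G3) in F4 *.
by rewrite (Prop_irrelevance F4 G4).
Qed.

(** * Localic and hyperconnected functors *)

Section Hyperconnected.
Context (E M : rcategory) (G : rfunctor E M).
Hypothesis G_hyperconnected : hyperconnected G.

Lemma hyperconnected_inj (A : E) (d d' : hom A A) :
  rst d = d -> rst d' = d' -> fmap G d = fmap G d' -> d = d'.
Proof.
move=> dd dd' Gdd'.
have /(congr1 sval) // : exist _ d dd = exist _ d' dd' :> ridem A.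
apply: (bij_inj (G_hyperconnected A)); rewrite /ridem_map.
by apply: eq_exist.
Qed.

Lemma hyperconnected_surj (A : E) (X : M) (e : G A = X) (d : hom X X) :
  rst d = d -> exists2 d' : hom A A, rst d' = d' & hcast e e (fmap G d') = d.
Proof.
case: _ / e d => d dd; have [s _ sK] := G_hyperconnected A.
exists (sval (s (exist _ d dd))); first exact: (svalP (s (exist _ d dd))).
exact: (congr1 sval (sK (exist _ d dd))).
Qed.

(** A map below [k] is determined by its restriction, so the order between maps
    below [k] is an order between restriction idempotents. There [d ⩽ d'] is the
    equation [d' ∘ d = d], which the injectivity of [G] reflects. *)
Lemma hyperconnected_reflects_le (A B : E) (j j' k : hom A B) :
  j ⩽ k -> j' ⩽ k -> fmap G j ⩽ fmap G j' -> j ⩽ j'.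
Proof.
move=> jk j'k Gjj'.
have dj : rst j' ∘ rst j = rst j.
  apply: hyperconnected_inj; rewrite ?rst_rst //.
    by rewrite rstR3 rst_rst.
  by rewrite fmapM !fmap_rst -rstR3 Gjj'.
by rewrite /hom_le -{1}j'k -compmA dj.
Qed.

Lemma hyperconnected_inj_below (A B : E) (j j' k : hom A B) :
  j ⩽ k -> j' ⩽ k -> fmap G j = fmap G j' -> j = j'.
Proof.
move=> jk j'k Gjj'.
by apply: le_antisym; apply: (@hyperconnected_reflects_le _ _ _ _ k) => //;
  rewrite Gjj' /hom_le rstR1.
Qed.

End Hyperconnected.

Lemma localic_directed (C D : rcategory) (F : rfunctor C D) (A B : C) (X Y : D)
    (eA : F A = X) (eB : F B = Y) (g : hom X Y) :
  localic F ->
  down_directed (@hom_le C A B) (fun f => g ⩽ hcast eA eB (fmap F f)).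
Proof. by move=> [_ Fdir]; case: _ / eA g; case: _ / eB => g; exact: Fdir. Qed.

(** * Lifts of maps through the square *)

Section Lift.
Context (C D E M : rcategory).
Context (H : rfunctor C E) (F : rfunctor C D).
Context (G : rfunctor E M) (K : rfunctor D M).
Hypothesis F_localic : localic F.
Hypothesis G_hyperconnected : hyperconnected G.

Context (GH_KF_ob : forall A, G (H A) = K (F A)).
Hypothesis GH_KF : forall (A B : C) (f : hom A B),
  hcast (GH_KF_ob A) (GH_KF_ob B) (fmap G (fmap H f)) = fmap K (fmap F f).

Context (p : D -> C) (pK : forall X, F (p X) = X).

Lemma lift_ob X : G (H (p X)) = K X.
Proof. by rewrite GH_KF_ob pK. Qed.

Definition above (X Y : D) (g : hom X Y) (f : hom (p X) (p Y)) : Prop :=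
  g ⩽ hcast (pK X) (pK Y) (fmap F f).

Definition is_lift (X Y : D) (g : hom X Y) (j : hom (H (p X)) (H (p Y))) :
    Prop :=
  hcast (lift_ob X) (lift_ob Y) (fmap G j) = fmap K g /\
  exists2 f, above g f & j ⩽ fmap H f.

Lemma lift_square (X Y : D) (f : hom (p X) (p Y)) :
  hcast (lift_ob X) (lift_ob Y) (fmap G (fmap H f)) =
  fmap K (hcast (pK X) (pK Y) (fmap F f)).
Proof.
rewrite (fmap_hcast _ _ (congr1 K (pK X)) (congr1 K (pK Y))) -GH_KF.
by rewrite (hcast_trans _ _ _ _ (lift_ob X) (lift_ob Y)).
Qed.

Lemma lift_exists (X Y : D) (g : hom X Y) : exists j, is_lift g j.
Proof.
have [[f gf] _] := localic_directed (pK X) (pK Y) g F_localic.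
have [d dd Gd] := hyperconnected_surj G_hyperconnected (lift_ob X)
  (rst_rst (fmap K g)).
exists (fmap H f ∘ d); split; last by exists f => //; exact: comp_ridem_le.
rewrite fmapM (hcast_comp _ (lift_ob X)) Gd lift_square.
exact: fmap_le gf.
Qed.

(** A lift found below one [H f] stays below [H f0] when [f0] is decreased
    towards [g], because [G] sees [K g ⩽ K (F f0)] and reflects it. This is what
    lets two lifts be compared below a single map. *)
Lemma lift_le (X Y : D) (g : hom X Y) j f f0 :
  hcast (lift_ob X) (lift_ob Y) (fmap G j) = fmap K g ->
  j ⩽ fmap H f -> f0 ⩽ f -> above g f0 -> j ⩽ fmap H f0.
Proof.
move=> Gj jf f0f gf0.
apply: (hyperconnected_reflects_le G_hyperconnected jf (fmap_le H f0f)).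
apply/(hcast_le (lift_ob X) (lift_ob Y)).
by rewrite Gj lift_square; exact: fmap_le.
Qed.

Lemma lift_unique (X Y : D) (g : hom X Y) j1 j2 :
  is_lift g j1 -> is_lift g j2 -> j1 = j2.
Proof.
move=> [Gj1 [f1 gf1 jf1]] [Gj2 [f2 gf2 jf2]].
have [_ /(_ _ _ gf1 gf2)] := localic_directed (pK X) (pK Y) g F_localic.
move=> [f0 [gf0 f01 f02]].
apply: (hyperconnected_inj_below G_hyperconnected
          (lift_le Gj1 jf1 f01 gf0) (lift_le Gj2 jf2 f02 gf0)).
by apply: (@hcast_inj _ _ _ _ _ (lift_ob X) (lift_ob Y)); rewrite Gj1.
Qed.

Lemma lift_id (X : D) : is_lift (idm X) (idm (H (p X))).
Proof.
split; first by rewrite !fmap1 hcast_idm.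
exists (idm _); last by rewrite fmap1 /hom_le rstR1.
by rewrite /above fmap1 hcast_idm /hom_le rstR1.
Qed.

Lemma lift_comp (X Y Z : D) (g : hom X Y) (h : hom Y Z) j k :
  is_lift g j -> is_lift h k -> is_lift (h ∘ g) (k ∘ j).
Proof.
move=> [Gj [f gf jf]] [Gk [f' hf' kf']]; split.
  by rewrite !fmapM (hcast_comp _ (lift_ob Y)) Gj Gk.
exists (f' ∘ f); last by rewrite fmapM; exact: le_comp.
by rewrite /above fmapM (hcast_comp _ (pK Y)); exact: le_comp.
Qed.

Lemma lift_rst (X Y : D) (g : hom X Y) j :
  is_lift g j -> is_lift (rst g) (rst j).
Proof.
move=> [Gj [f gf jf]]; split.
  by rewrite !fmap_rst (hcast_rst _ (lift_ob Y)) Gj.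
exists (rst f); last by rewrite fmap_rst; exact: le_rst.
by rewrite /above fmap_rst (hcast_rst _ (pK Y)); exact: le_rst.
Qed.

(** This is what makes the filler extend [H]: [f] itself is a map above [F f].
    The transport is there because lifts live between the objects [p (F A)] and
    [p (F B)], which are only propositionally equal to [A] and [B]. *)
Lemma lift_fmap (A B : C) (eA : A = p (F A)) (eB : B = p (F B))
    (f : hom A B) :
  is_lift (fmap F f) (fmap H (hcast eA eB f)).
Proof.
have Ff : hcast (pK (F A)) (pK (F B)) (fmap F (hcast eA eB f)) = fmap F f.
  rewrite (fmap_hcast _ _ (congr1 F eA) (congr1 F eB)).
  by rewrite (hcast_trans _ _ _ _ erefl erefl).
split; first by rewrite lift_square Ff.
exists (hcast eA eB f); last by rewrite /hom_le rstR1.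
by rewrite /above Ff /hom_le rstR1.
Qed.

(** [G J = K] is the first clause of [is_lift]. The second follows from
    [J F = H] because [J], like every restriction functor, is monotone. *)
Lemma filler_lift (J : rfunctor D E) (e : forall X, J X = H (p X))
    (X Y : D) (g : hom X Y) :
  J ⊚ F = H -> G ⊚ J = K -> is_lift g (hcast (e X) (e Y) (fmap J g)).
Proof.
move=> /rfunctor_eqP [eH JF] /rfunctor_eqP [eK GJ]; split.
  rewrite (fmap_hcast _ _ (congr1 G (e X)) (congr1 G (e Y))).
  by rewrite (hcast_trans _ _ _ _ (eK X) (eK Y)); exact: GJ.
have [[f gf] _] := localic_directed (pK X) (pK Y) g F_localic.
exists f => //.
have := fmap_le J gf.
rewrite (fmap_hcast _ _ (congr1 J (pK X)) (congr1 J (pK Y))).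
move=> /(hcast_le (e X) (e Y)).
by rewrite (hcast_trans _ _ _ _ (eH (p X)) (eH (p Y))) -JF.
Qed.

Definition filler_map (X Y : D) (g : hom X Y) : hom (H (p X)) (H (p Y)) :=
  sval (cid (lift_exists g)).

Lemma filler_mapP (X Y : D) (g : hom X Y) : is_lift g (filler_map g).
Proof. exact: svalP. Qed.

Lemma filler_map1 (X : D) : filler_map (idm X) = idm (H (p X)).
Proof. exact: lift_unique (filler_mapP _) (lift_id X). Qed.

Lemma filler_mapM (X Y Z : D) (h : hom Y Z) (g : hom X Y) :
  filler_map (h ∘ g) = filler_map h ∘ filler_map g.
Proof.
exact: lift_unique (filler_mapP _) (lift_comp (filler_mapP _) (filler_mapP _)).
Qed.

Definition filler_functor : functor D E :=
  @Functor D E (fun X => H (p X)) filler_map filler_map1 filler_mapM.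

Lemma filler_rst (X Y : D) (g : hom X Y) :
  fmap filler_functor (rst g) = rst (fmap filler_functor g).
Proof. exact: lift_unique (filler_mapP _) (lift_rst (filler_mapP _)). Qed.

Definition filler : rfunctor D E := RFunctor filler_rst.

Lemma filler_comp_F : cancel F p -> filler ⊚ F = H.
Proof.
move=> FK; apply/rfunctor_eqP.
exists (fun A => congr1 H (FK A)) => A B f /=.
rewrite (lift_unique (filler_mapP _)
           (lift_fmap (esym (FK A)) (esym (FK B)) f)).
rewrite -(fmap_hcast (FK A) (FK B)).
by rewrite (hcast_trans _ _ _ _ erefl erefl).
Qed.

Lemma G_comp_filler : G ⊚ filler = K.
Proof.
apply/rfunctor_eqP; exists lift_ob => X Y g.
by have [] := filler_mapP g.
Qed.

Lemma filler_unique (J : rfunctor D E) :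
  J ⊚ F = H -> G ⊚ J = K -> filler = J.
Proof.
move=> JF GJ; have [eH _] := (rfunctor_eqP _ _).1 JF.
have e X : J X = H (p X) by rewrite -{1}(pK X); exact: eH.
apply/rfunctor_eqP; exists (fun X => esym (e X)) => X Y g /=.
rewrite (lift_unique (filler_mapP g) (filler_lift e g JF GJ)).
by rewrite (hcast_trans _ _ _ _ erefl erefl).
Qed.

End Lift.

(** * Orthogonality *)

Theorem proposition2p2 (C D E M : rcategory)
    (H : rfunctor C E) (F : rfunctor C D) (G : rfunctor E M) (K : rfunctor D M)
    (F_localic : localic F) (G_hyperconnected : hyperconnected G)
    (GH_KF : G ⊚ H = K ⊚ F) :
  exists! J : rfunctor D E, J ⊚ F = H /\ G ⊚ J = K.
Proof.
have [[p FK pK] _] := F_localic.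
have [e GHKF] := (rfunctor_eqP _ _).1 GH_KF.
exists (filler F_localic G_hyperconnected GHKF pK); split.
  by split; [exact: filler_comp_F | exact: G_comp_filler].
by move=> J [JF GJ]; exact: filler_unique.
Qed.
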